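(* Let $t(n,k)$ be the number of paths in $\mathcal{M}'_1$ of length $n$ whose end-point has height $k$, and let $\mathit{Total}(z,u)=\sum_{n,k\ge 0}t(n,k)z^nu^k$ be the bivariate generating function of the paths in $\mathcal{M}'_1$ with respect to the length and the height of the end-point. Then $$\mathit{Total}(z,u)=1+\frac{s(1+rz+ruz)}{r-u},$$ and for every $k\ge 0$ $$[u^k]\,\mathit{Total}(z,u)=[k=0]+\frac{s(rz+1)}{r^{k+1}}+(1-[k=0])\cdot\frac{sz}{r^{k-1}}.$$ Moreover, for $n\geq 2$, $k\geq 1$, $$t(n,k)=t(n-2,k-1)+t(n-2,k)-t(n-1,k-1)+t(n-1,k+1)+t(n,k-1),$$ and, setting $t_n:=t(n,0)$, for $n\ge 2$, $$t_n=t_{n-1}+t_{n-2}+\sum_{k=0}^{n-3}t_{k}t_{n-k-3}+\sum_{k=2}^{n-1}\left(t_k-t_{k-1}\right)t_{n-k-1}.$$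
   Context: $\mathcal{M}'_1$ is the set of lattice paths in $\mathbb{N}^2$ (with $\mathbb{N}=\{0,1,2,\dots\}$, so paths never go below the $x$-axis) starting at the origin, made of up steps $(1,k)$ with $k\ge 1$, down steps $(1,-1)$ and horizontal steps $(1,0)$, in which two up steps are never consecutive. (They arise by reading from right to left paths with steps $(1,1)$, $(1,0)$, $(1,-k)$, $k\ge1$, having no two consecutive down steps.) The empty path belongs to $\mathcal{M}'_1$. The length of a path is its number of steps; the height of a point is its ordinate. $[k=0]$ is $1$ if $k=0$ and $0$ otherwise. Empty sums are $0$. The power series $r,s$ in $z$ are $$r=\frac{1-z^{2}+\sqrt{z^{4}-4z^{3}+2z^{2}-4z+1}}{2(z^{2}-z+1)},\qquad s=\frac{1-z^{2}-\sqrt{z^{4}-4z^{3}+2z^{2}-4z+1}}{2(z^{2}-z+1)},$$ where the square root is the power series with constant term $1$. The fraction $1/(r-u)$ is expanded as $\sum_{k\ge0}u^k/r^{k+1}$. *)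

(* Defs.v *)
From HB Require Import structures.
From mathcomp Require Import all_boot all_order all_algebra.
From mathcomp Require Import zify.
From mathcomp Require Import finmap boolp classical_sets functions cardinality.

Set Implicit Arguments.
Unset Strict Implicit.
Unset Printing Implicit Defensive.

Import Order.TTheory GRing.Theory Num.Theory.
Local Open Scope ring_scope.

(** * Formal power series over a commutative ring *)

(* [fps R] is R[[X]]; [f n] is the coefficient of X^n in [f]. *)
Record fps (R : Type) := FPS { coefs :> nat -> R }.

HB.instance Definition _ (R : Type) := gen_eqMixin (fps R).
HB.instance Definition _ (R : Type) := gen_choiceMixin (fps R).

Lemma fpsP (R : Type) (f g : fps R) : (forall n, f n = g n) <-> f = g.
Proof.
split=> [|-> //]; case: f g => [f] [g] /= fg; congr FPS; exact: funext.
Qed.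

Section Ring.
Variable R : comNzRingType.
Implicit Types f g h : fps R.

Definition fps_zero : fps R := FPS (fun _ => 0).
Definition fps_opp f : fps R := FPS (fun n => - f n).
Definition fps_add f g : fps R := FPS (fun n => f n + g n).
Definition fpsC (c : R) : fps R := FPS (fun n => if n == 0%N then c else 0).
Definition fps_mul f g : fps R :=
  FPS (fun n => \sum_(i < n.+1) f i * g (n - i)%N).

Lemma fps_addA : associative fps_add.
Proof. by move=> f g h; apply/fpsP => n /=; rewrite addrA. Qed.

Lemma fps_addC : commutative fps_add.
Proof. by move=> f g; apply/fpsP => n /=; rewrite addrC. Qed.

Lemma fps_add0 : left_id fps_zero fps_add.
Proof. by move=> f; apply/fpsP => n /=; rewrite add0r. Qed.

Lemma fps_addN : left_inverse fps_zero fps_opp fps_add.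
Proof. by move=> f; apply/fpsP => n /=; rewrite addNr. Qed.

HB.instance Definition _ :=
  GRing.isZmodule.Build (fps R) fps_addA fps_addC fps_add0 fps_addN.

Let trunc n f : {poly R} := \poly_(i < n.+1) f i.

Let truncE n f i : (i <= n)%N -> (trunc n f)`_i = f i.
Proof. by move=> lin; rewrite coef_poly ltnS lin. Qed.

Let mul_trunc n f g i :
  (i <= n)%N -> fps_mul f g i = (trunc n f * trunc n g)`_i.
Proof.
move=> lin; rewrite coefM; apply: eq_bigr => j _.
have lji : (j <= i)%N by rewrite -ltnS.
by rewrite !truncE // ?(leq_trans lji) // (leq_trans _ lin) ?leq_subr.
Qed.

Lemma fps_mulA : associative fps_mul.
Proof.
move=> f g h; apply/fpsP => n.
transitivity (trunc n f * (trunc n g * trunc n h))`_n.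
  rewrite coefM; apply: eq_bigr => j _.
  by rewrite -mul_trunc ?leq_subr // truncE // -ltnS.
rewrite mulrA coefM; apply: eq_bigr => j _.
by rewrite -mul_trunc -1?ltnS // truncE // leq_subr.
Qed.

Lemma fps_mulC : commutative fps_mul.
Proof.
by move=> f g; apply/fpsP => n; rewrite !(@mul_trunc n) // mulrC.
Qed.

Lemma fps_mul1 : left_id (fpsC 1) fps_mul.
Proof.
move=> f; apply/fpsP => n /=.
by rewrite big_ord_recl /= mul1r subn0 big1 ?addr0 // => i _; rewrite mul0r.
Qed.

Lemma fps_mulDl : left_distributive fps_mul fps_add.
Proof.
move=> f g h; apply/fpsP => n /=.
by rewrite -big_split; apply: eq_bigr => i _; rewrite mulrDl.
Qed.

Lemma fps_1neq0 : fpsC 1 != 0.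
Proof. by apply/eqP => /fpsP/(_ 0%N)/eqP; rewrite /= oner_eq0. Qed.

HB.instance Definition _ := GRing.Zmodule_isComNzRing.Build (fps R)
  fps_mulA fps_mulC fps_mul1 fps_mulDl fps_1neq0.

Definition fpsX : fps R := FPS (fun n => (n == 1%N)%:R).

Lemma fps0E n : (0 : fps R) n = 0. Proof. by []. Qed.
Lemma fps1E n : (1 : fps R) n = (n == 0%N)%:R. Proof. by case: n. Qed.
Lemma fpsDE f g n : (f + g) n = f n + g n. Proof. by []. Qed.
Lemma fpsNE f n : (- f) n = - f n. Proof. by []. Qed.
Lemma fpsME f g n : (f * g) n = \sum_(i < n.+1) f i * g (n - i)%N.
Proof. by []. Qed.

Lemma fpsM0 f g : (f * g) 0%N = f 0%N * g 0%N.
Proof. by rewrite fpsME big_ord1. Qed.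

Lemma fpsCM c f n : (fpsC c * f) n = c * f n.
Proof.
by rewrite fpsME big_ord_recl /= subn0 big1 ?addr0 // => i _; rewrite mul0r.
Qed.

Lemma fpsXM f n : (fpsX * f) n = if n is m.+1 then f m else 0.
Proof.
rewrite fpsME big_ord_recl /= mul0r add0r.
case: n => [|n]; first by rewrite big_ord0.
rewrite big_ord_recl /= mul1r subSS subn0 big1 ?addr0 // => i _.
by rewrite mul0r.
Qed.

End Ring.

Arguments fpsX {R}.
Notation "c %:S" := (fpsC c) (at level 2, left associativity, format "c %:S")
  : ring_scope.

(* Course-of-values recursion: [rec_coef F n] is [F] applied to the sequence of
   the [n] previous values. *)
Section CourseOfValues.
Variables (R : nmodType) (F : seq R -> R).

Fixpoint rec_seq n : seq R :=
  if n is m.+1 then rcons (rec_seq m) (F (rec_seq m)) else [::].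

Definition rec_coef n : R := F (rec_seq n).

Lemma size_rec_seq n : size (rec_seq n) = n.
Proof. by elim: n => //= n IH; rewrite size_rcons IH. Qed.

Lemma nth_rec_seq n i : (i < n)%N -> (rec_seq n)`_i = rec_coef i.
Proof.
elim: n => // n IH; rewrite ltnS leq_eqVlt /= nth_rcons size_rec_seq.
by case/predU1P => [-> | lin]; rewrite ?ltnn ?eqxx // lin IH.
Qed.

End CourseOfValues.

Section UnitRing.
Variable R : comUnitRingType.
Implicit Types f g : fps R.

Definition fps_unit : pred (fps R) := fun f => f 0%N \is a GRing.unit.

Definition fps_inv f : fps R :=
  if fps_unit f then
    FPS (rec_coef (fun s => (f 0%N)^-1 *
      ((size s == 0%N)%:R - \sum_(i < size s) s`_i * f (size s - i)%N)))
  else f.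

Lemma fps_invE f n : fps_unit f -> fps_inv f n =
  (f 0%N)^-1 * ((n == 0%N)%:R - \sum_(i < n) fps_inv f i * f (n - i)%N).
Proof.
move=> uf; rewrite /fps_inv uf {1}/coefs {1}/rec_coef size_rec_seq.
by congr (_ * (_ - _)); apply: eq_bigr => i _; rewrite nth_rec_seq.
Qed.

Lemma fps_mulVf : {in fps_unit, left_inverse 1 fps_inv *%R}.
Proof.
move=> f uf; apply/fpsP => n; rewrite fpsME fps1E big_ord_recr /= subnn.
by rewrite [fps_inv f n]fps_invE // mulrAC mulVr // mul1r addrC subrK.
Qed.

Lemma fps_unitP f g : g * f = 1 -> fps_unit f.
Proof.
move=> /fpsP/(_ 0%N); rewrite fpsM0 fps1E /= => gf1.
by apply/unitrPr; exists (g 0%N); rewrite mulrC.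
Qed.

Lemma fps_inv_out : {in [predC fps_unit], fps_inv =1 id}.
Proof. by move=> f; rewrite inE /fps_inv => /negPf; rewrite /in_mem /= => ->. Qed.

HB.instance Definition _ := GRing.ComNzRing_hasMulInverse.Build (fps R)
  fps_mulVf fps_unitP fps_inv_out.

Lemma fps_unitE f : (f \is a GRing.unit) = (f 0%N \is a GRing.unit).
Proof. by []. Qed.

(* Inversion in R[[X]] expands 1/(a - X) as \sum_k X^k / a^(k+1). *)
Lemma fps_inv_subX (a : R) : a \is a GRing.unit ->
  (a%:S - fpsX)^-1 = FPS (fun k => (a ^+ k.+1)^-1).
Proof.
move=> ua; have ufa : a%:S - fpsX \is a GRing.unit.
  by rewrite fps_unitE fpsDE fpsNE /= subr0.
apply: (mulrI ufa); rewrite divrr //; apply/fpsP => n.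
rewrite mulrBl fpsDE fpsNE fpsCM fpsXM fps1E.
case: n => [|n] /=; first by rewrite expr1 divrr // subr0.
by rewrite exprS invrM ?unitrX // mulrCA divrr // mulr1 subrr.
Qed.

(* The square root with constant term 1 of a series with constant term 1. *)
Definition fps_sqrt f : fps R :=
  FPS (rec_coef (fun s => if size s == 0%N then 1 else
    2^-1 * (f (size s) - \sum_(1 <= i < size s) s`_i * s`_(size s - i)))).

Lemma fps_sqrt0 f : fps_sqrt f 0%N = 1. Proof. by []. Qed.

Lemma fps_sqrtS f n : fps_sqrt f n.+1 =
  2^-1 * (f n.+1 -
          \sum_(1 <= i < n.+1) fps_sqrt f i * fps_sqrt f (n.+1 - i)%N).
Proof.
rewrite {1}/fps_sqrt {1}/coefs {1}/rec_coef size_rec_seq [_ == _]/=.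
congr (_ * (_ - _)); apply: eq_big_nat => i /andP[i0 lin].
by rewrite !nth_rec_seq // -subn_gt0 subKn // ltnW.
Qed.

Lemma fps_sqrE f n : f 0%N = 1 ->
  (f ^+ 2) n.+1 = 2 * f n.+1 + \sum_(1 <= i < n.+1) f i * f (n.+1 - i)%N.
Proof.
move=> f1; rewrite expr2 fpsME.
rewrite -(big_mkord xpredT (fun i => f i * f (n.+1 - i)%N)).
rewrite big_nat_recr //= big_ltn // subn0 subnn f1 mul1r mulr1.
by rewrite addrAC -mulr2n mulr_natl.
Qed.

Lemma fps_sqrtK f : (2 : R) \is a GRing.unit -> f 0%N = 1 ->
  fps_sqrt f ^+ 2 = f.
Proof.
move=> u2 f1; apply/fpsP => -[|n]; first by rewrite fpsM0 fps_sqrt0 mulr1 f1.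
by rewrite fps_sqrE // {1}fps_sqrtS mulVKr // subrK.
Qed.

Lemma fps_sqrt_uniq f g : (2 : R) \is a GRing.unit ->
  g 0%N = 1 -> g ^+ 2 = f -> g = fps_sqrt f.
Proof.
move=> u2 g1 gf; apply/fpsP => n; elim/ltn_ind: n => -[_|n IH].
  by rewrite fps_sqrt0.
have fE : f n.+1 = (g ^+ 2) n.+1 by rewrite gf.
rewrite fps_sqrtS fE fps_sqrE //.
rewrite [X in _ - X](eq_big_nat _ _ (F2 := fun i => g i * g (n.+1 - i)%N)).
  by rewrite addrK mulKr.
move=> i /andP[i0 lin]; rewrite -!IH // ltn_subrL i0.
by rewrite (leq_trans _ lin).
Qed.

End UnitRing.

(** * Lattice paths *)

(* Every step advances the abscissa by 1, so a path from the origin is given by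
   the sequence of its vertical increments: the step (1, a) is encoded as [a].
   The length of the path is the size of the sequence. *)
Definition lpath := seq int.

Definition is_up (a : int) : bool := 1 <= a.
Definition is_step (a : int) : bool := [|| is_up a, a == -1 | a == 0].

Definition height (p : lpath) : int := \sum_(a <- p) a.

Definition no_two_up (p : lpath) : bool :=
  sorted (fun a b => ~~ (is_up a && is_up b)) p.

Definition nonneg_path (p : lpath) : bool :=
  [forall i : 'I_(size p).+1, 0 <= height (take i p)].

Definition in_M1 (p : lpath) : bool :=
  [&& all is_step p, no_two_up p & nonneg_path p].

Definition paths (n k : nat) : set lpath :=
  [set p | [/\ in_M1 p, size p = n & height p = k%:Z]]%classic.

Lemma finite_paths n k : finite_set (paths n k).
Proof.
pose N := (n + k).+2.
pose dec (w : n.-tuple 'I_N) : lpath := [seq (nat_of_ord i)%:Z - 1 | i <- w].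
apply: (@sub_finite_set _ _ (dec @` [set: n.-tuple 'I_N])%classic); last first.
  exact/finite_image/finite_finset.
have lb (q : lpath) : all is_step q -> - (size q)%:Z <= height q.
  elim: q => [|a q IH] /=; rewrite /height ?big_nil ?oppr0 // big_cons.
  case/andP=> sa /IH; rewrite intS opprD => /(lerD _) -> //.
  by case/or3P: sa => [/(le_trans _)-> | /eqP-> | /eqP->].
move=> p [/and3P[stp _ /forallP nn] szp hp].
have bnd (a : int) : a \in p -> exists2 i : 'I_N, (i : nat)%:Z - 1 = a & true.
  move=> ap; have sa := allP stp _ ap.
  have a1 : 0 <= a + 1.
    by rewrite -lerBlDr sub0r; case/or3P: sa => [/(le_trans _)-> | /eqP-> | /eqP->].
  have ltj : (index a p < (size p).+1)%N by rewrite ltnS index_size.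
  have lejp : (index a p < size p)%N by rewrite index_mem.
  have := nn (Ordinal ltj); rewrite /= => h0.
  pose q := drop (index a p).+1 p.
  have hE : height (take (index a p) p) + (a + height q) = k%:Z.
    by rewrite -hp -[in RHS](cat_take_drop (index a p) p) [in RHS](drop_nth 0) //
         nth_index // /height big_cat big_cons.
  have hq : - n%:Z <= height q.
    apply: le_trans (lb q _); last by apply/allP => x /mem_drop /(allP stp).
    by rewrite lerN2 lez_nat -szp size_drop leq_subr.
  have ale : a <= (n + k)%:Z.
    move: (height q) (height _) hE hq h0 => hq ht; lia.
  have [m am] : exists m : nat, a + 1 = m%:Z by exists (absz (a + 1)); rewrite gez0_abs.
  have ltm : (m < N)%N by rewrite /N ltnS -lez_nat -am -addn1 PoszD lerD2r.
  by exists (Ordinal ltm) => //=; rewrite -am addrK.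
pose enc a : 'I_N := inord (absz (a + 1)).
have szw : size (map enc p) == n by rewrite size_map szp.
exists (Tuple szw) => //=; rewrite /dec /= -map_comp -[RHS]map_id.
apply/eq_in_map => a ap /=; have [i <- _] := bnd a ap.
by rewrite /enc subrK absz_nat inord_val.
Qed.

(* [fset_set] of a finite set is the set itself (finiteness is
   [finite_paths]). *)
Definition t (n k : nat) : nat := #|` fset_set (paths n k)|.

(** * Generating functions *)

(* Series in z are elements of [fps rat]; bivariate series are elements of
   [fps (fps rat)], that is, series in u with coefficients in Q[[z]]. *)
Definition zvar : fps rat := fpsX.
Definition uvar : fps (fps rat) := fpsX.

Definition Total : fps (fps rat) := FPS (fun k => FPS (fun n => (t n k)%:R)).

Definition discr : fps rat :=
  zvar ^+ 4 - 4 * zvar ^+ 3 + 2 * zvar ^+ 2 - 4 * zvar + 1.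

Definition rser : fps rat :=
  (1 - zvar ^+ 2 + fps_sqrt discr) / (2 * (zvar ^+ 2 - zvar + 1)).

Definition sser : fps rat :=
  (1 - zvar ^+ 2 - fps_sqrt discr) / (2 * (zvar ^+ 2 - zvar + 1)).

Lemma discr0 : discr 0%N = 1.
Proof.
rewrite /discr !(fpsDE, fpsNE, fpsM0, exprS, expr0, fps1E) /=.
by rewrite /zvar /= !(mul0r, mulr0, subr0, add0r).
Qed.

Lemma sqrt_discrK : fps_sqrt discr ^+ 2 = discr.
Proof. by apply: fps_sqrtK => //; exact: discr0. Qed.

Lemma denom_unit : 2 * (zvar ^+ 2 - zvar + 1) \is a GRing.unit.
Proof.
rewrite fps_unitE fpsM0 !(fpsDE, fpsNE, fpsM0, exprS, expr0, fps1E) /=.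
by rewrite /zvar /= !(mul0r, mulr0, subr0, add0r) mulr1.
Qed.

Lemma rser_unit : rser \is a GRing.unit.
Proof.
rewrite /rser unitrMl ?unitrV ?denom_unit // fps_unitE.
rewrite !(fpsDE, fpsNE, fpsM0, exprS, expr0, fps1E) /=.
by rewrite /zvar /= !(mul0r, mulr0, subr0, add0r).
Qed.

Lemma inv_r_sub_u :
  (rser%:S - uvar)^-1 = FPS (fun k => (rser ^+ k.+1)^-1).
Proof. exact: fps_inv_subX rser_unit. Qed.

(* Main.v *)
Require Import Defs.
From mathcomp Require Import all_boot all_order all_algebra.
From mathcomp Require Import zify ring lra finmap boolp classical_sets cardinality.

Set Implicit Arguments.
Unset Strict Implicit.
Unset Printing Implicit Defensive.

Import Order.TTheory GRing.Theory Num.Theory.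
Local Open Scope ring_scope.

(** The proof looks at the last step of a path.

    Split the paths of length [n] ending at height [k] into those whose last
    step is an up step and the others.  A path of the second kind is any path
    ending at height [k] or [k + 1] followed by a horizontal or a down step.  A
    path of the first kind is a path of the second kind, ending at any height
    [j < k], followed by the up step [k - j].  Comparing heights [k] and [k + 1]
    turns that sum over [j] into a single term.  Adding the two kinds gives
    linear recurrences for [t] alone ([t_axis_rec], [t_height_rec]), hence for
    the series [Total k] in z ([Total0], [TotalS]).

    These recurrences determine the series, because every term of length [n]
    is obtained from shorter lengths and from smaller heights
    ([kernel_recurrence_uniq]).  So it is enough to exhibit a solution, and no
    cancellation of the kernel of a functional equation is needed.  For large
    [k] the recurrence is linear homogeneous with characteristic equation
    z q^2 - (1 - z^2) q + (z^2 - z + 1) = 0, whose root that is a power series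
    is q = 1/r.

    With D = z^2 - z + 1, the series r and s are the two roots of
    D x^2 - (1 - z^2) x + z = 0.  Put A = 1/(D r); then s = z A, 1/r = D A and
    A = 1 + z^2 A + z D A^2.  All the closed forms are polynomials in z, D, A
    and powers of 1/r, and each identity between them is a multiple of that one
    quadratic relation.  The solution found this way is [height_ser], with
    [Total 0] = A, so the same quadratic relation read coefficientwise is the
    convolution formula for t(n, 0). *)

(** * Adding one step to a path *)

(** The default 0 makes the empty path behave like a path ending with a
    horizontal step: any step allowed by its height may follow. *)
Definition ends_up (p : lpath) : bool := is_up (last 0 p).

Lemma height_rcons p a : height (rcons p a) = height p + a.
Proof. by rewrite /height -cats1 big_cat big_seq1. Qed.

Lemma nonneg_path_rcons p a :
  nonneg_path (rcons p a) = nonneg_path p && (0 <= height p + a).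
Proof.
apply/forallP/andP => [pos | [/forallP pos posa] [i /=]].
  split; last first.
    have := pos ord_max; rewrite /= -[X in take X]/(size (rcons p a)).
    by rewrite take_size height_rcons.
  apply/forallP => -[i lti].
  have lti' : (i < (size (rcons p a)).+1)%N by rewrite size_rcons ltnW.
  by have := pos (Ordinal lti'); rewrite /= -cats1 takel_cat.
rewrite ltnS leq_eqVlt size_rcons ltnS => /predU1P[-> | lei].
  by rewrite -(size_rcons p a) take_size height_rcons.
by rewrite -cats1 takel_cat //; apply: (pos (Ordinal (lei : (i < (size p).+1)%N))).
Qed.

Lemma in_M1_rcons p a :
  in_M1 (rcons p a) =
  [&& in_M1 p, is_step a, ~~ (ends_up p && is_up a) & 0 <= height p + a].
Proof.
rewrite /in_M1 all_rcons nonneg_path_rcons.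
have -> : no_two_up (rcons p a) = no_two_up p && ~~ (ends_up p && is_up a).
  by case: p => [|b p] //=; rewrite /no_two_up /= rcons_path.
by case: (is_step a); case: (all _ _); case: (no_two_up _); rewrite ?andbF //= andbCA.
Qed.

Lemma in_M1_height_ge0 p : in_M1 p -> 0 <= height p.
Proof.
by case/and3P => _ _ /forallP/(_ ord_max); rewrite /= take_size.
Qed.

(** * Enumerating paths by their last step *)

(** The boolean tells whether the last step is an up step.  In the up case [j]
    is the height before that step, and the path before it may not end up. *)
Fixpoint pathlist (n : nat) (b : bool) (k : nat) : seq lpath :=
  match n, b with
  | 0%N, _ => if ~~ b && (k == 0%N) then [:: [::]] else [::]
  | m.+1, true =>
      [seq rcons p (k%:Z - j%:Z) | j <- iota 0 k, p <- pathlist m false j]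
  | m.+1, false =>
      [seq rcons p 0 | p <- pathlist m true k ++ pathlist m false k] ++
      [seq rcons p (-1) | p <- pathlist m true k.+1 ++ pathlist m false k.+1]
  end.

(** By induction on the length: the last step of a path can be read off from
    the heights before and after it, and prefixes of paths are paths. *)
Lemma mem_pathlist n b k p :
  (p \in pathlist n b k) =
  [&& in_M1 p, size p == n, height p == k%:Z & ends_up p == b].
Proof.
elim: n b k p => [|n IH] b k p.
  case: p => [|x p]; last by rewrite /= andbF; case: ifP.
  rewrite /= /height big_nil /in_M1 /no_two_up /nonneg_path /ends_up /=.
  have -> : [forall i : 'I_1, 0 <= height (take i [::])].
    by apply/forallP => i; rewrite /= /height big_nil.
  by case: b k => [] [|k].
have memU q j : (q \in pathlist n true j ++ pathlist n false j) =
    [&& in_M1 q, size q == n & height q == j%:Z].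
  by rewrite mem_cat !IH; case: (ends_up q); rewrite ?andbT ?andbF ?orbF.
case/lastP: p => [|p a].
  rewrite /= andbF; case: b => /=.
    by apply/negP => /allpairsPdep[j [q [_ _ /(congr1 size)]]]; rewrite size_rcons.
  rewrite mem_cat; apply/negP => /orP[] /mapP[q _ /(congr1 size)];
  by rewrite size_rcons.
rewrite size_rcons eqSS height_rcons in_M1_rcons {2}/ends_up last_rcons.
case: b => /=.
  apply/allpairsPdep/idP => [[j [q []]] | ].
    rewrite mem_iota IH add0n /= => ltjk /and4P[Mq szq /eqP hq /eqP nuq].
    case/rcons_inj => -> ->; rewrite Mq szq hq nuq /is_step /is_up /=.
    by lia.
  case/and4P=> /and4P[Mp sta up pos] szp /eqP hp /eqP upa.
  have := in_M1_height_ge0 Mp; move: up upa; rewrite andbC => /[swap] upa.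
  rewrite upa /= => nup hp0; exists (absz (height p)), p.
  move: upa; rewrite mem_iota IH Mp szp (negPf nup) /= add0n /is_up => upa.
  split; [by lia|by lia|congr rcons; lia].
rewrite mem_cat.
have memR (c : int) s : (rcons p a \in [seq rcons q c | q <- s]) = (a == c) && (p \in s).
  apply/mapP/andP => [[q qs /rcons_inj[-> ->]] | [/eqP-> ps]]; last by exists p.
  by rewrite eqxx.
rewrite !memR !memU.
case Mp: (in_M1 p); rewrite ?andbF //= => {IH memU memR}.
case szp: (size p == n); rewrite ?andbF //=.
have := in_M1_height_ge0 Mp; rewrite /is_step /is_up.
by case: (ends_up p) => /=; lia.
Qed.

(** A path determines its last step and its prefix, so no list built above
    repeats an element; in the up case the step [k - j] determines [j]. *)
Lemma pathlist_uniq n b k : uniq (pathlist n b k).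
Proof.
elim: n b k => [|n IH] b k; first by rewrite /=; case: ifP.
have uU j : uniq (pathlist n true j ++ pathlist n false j).
  rewrite cat_uniq !IH /= andbT; apply/hasPn => q.
  by rewrite !mem_pathlist => /and4P[_ _ _ /eqP->]; rewrite !andbF.
case: b => /=.
  apply: allpairs_uniq_dep => [||[i p] [j q]]; rewrite ?iota_uniq //.
  case/allpairsPdep => i' [p' [_ p'i [-> ->]]].
  case/allpairsPdep => j' [q' [_ q'j [-> ->]]] /= /rcons_inj[pq ij].
  by congr existT; first lia.
have inj (c : int) : injective (fun p : lpath => rcons p c).
  by move=> p q /rcons_inj[].
rewrite cat_uniq !map_inj_uniq // !uU /= andbT.
by apply/hasPn => p /mapP[q _ ->]; apply/mapP => -[q' _ /rcons_inj[]].
Qed.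

Lemma t_pathlist n k : t n k = (size (pathlist n true k) + size (pathlist n false k))%N.
Proof.
rewrite -size_cat /t.
have -> : fset_set (paths n k) =
          [fset p in pathlist n true k ++ pathlist n false k]%fset.
  apply/fsetP => p; rewrite in_fset_set; last exact: finite_paths.
  rewrite in_fset /= mem_cat !mem_pathlist; apply/idP/idP.
    by rewrite in_setE => -[-> -> ->]; case: ends_up; rewrite !eqxx.
  by move=> h; rewrite in_setE; case/orP: h => /and4P[? /eqP ? /eqP ? _]; split.
rewrite card_fseq undup_id // cat_uniq !pathlist_uniq /= andbT.
by apply/hasPn => q; rewrite !mem_pathlist => /and4P[_ _ _ /eqP->]; rewrite !andbF.
Qed.

Lemma size_pathlist_flat n k :
  size (pathlist n.+1 false k) = (t n k + t n k.+1)%N.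
Proof. by rewrite /= size_cat !size_map !size_cat !t_pathlist. Qed.

Lemma size_pathlist_up0 n : size (pathlist n true 0) = 0%N.
Proof. by case: n. Qed.

(** The sum over all heights before the last step telescopes: bijectively,
    lengthening the final up step by one raises the end-point by one, and only
    the paths with final step 1 are missed. *)
Lemma size_pathlist_up n k :
  size (pathlist n.+1 true k.+1) =
  (size (pathlist n.+1 true k) + size (pathlist n false k))%N.
Proof.
have sumE j : size (pathlist n.+1 true j) =
    (\sum_(0 <= i < j) size (pathlist n false i))%N.
  by rewrite size_allpairs_dep sumnE big_map /index_iota subn0.
by rewrite !sumE big_nat_recr.
Qed.

(** * Recurrences for the numbers of paths *)

Lemma t_height_rec n k :
  (t n.+2 k.+1)%:Z = (t n k)%:Z + (t n k.+1)%:Z - (t n.+1 k)%:Z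
                     + (t n.+1 k.+2)%:Z + (t n.+2 k)%:Z.
Proof.
have := t_pathlist n.+2 k; have := t_pathlist n.+2 k.+1.
rewrite !size_pathlist_flat !size_pathlist_up !size_pathlist_flat; lia.
Qed.

(** No path ends on the axis with an up step. *)
Lemma t_axis_rec n : t n.+1 0 = (t n 0 + t n 1)%N.
Proof. by rewrite [LHS]t_pathlist size_pathlist_flat size_pathlist_up0. Qed.

Lemma t0 k : t 0 k = (k == 0%N).
Proof. by rewrite t_pathlist; case: k. Qed.

Lemma t1S k : t 1 k.+1 = 1%N.
Proof.
rewrite t_pathlist size_pathlist_flat !t0 addn0; elim: k => // k IH.
by rewrite size_pathlist_up /= addn0.
Qed.

(** * Recurrences for the series in z *)

Lemma Total0 : Total 0 = 1 + zvar * (Total 0 + Total 1).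
Proof.
apply/fpsP => -[|n]; rewrite fpsDE fpsXM fps1E /=.
  by rewrite t0.
by rewrite t_axis_rec natrD add0r.
Qed.

(** This form comes from eliminating the series F_k of the paths that end with
    an up step and the series G_k of the others from
    F_(k+1) = F_k + z G_k, G_k = [k = 0] + z (Total k + Total (k+1)). *)
Lemma TotalS k : Total k.+1 =
  Total k + zvar * (Total k.+1 + Total k.+2)
  - (1 - zvar) * ((k == 0%N)%:R + zvar * (Total k + Total k.+1)).
Proof.
have -> : Total k + zvar * (Total k.+1 + Total k.+2)
  - (1 - zvar) * ((k == 0%N)%:R + zvar * (Total k + Total k.+1)) =
  Total k - (k == 0%N)%:R +
    zvar * ((k == 0%N)%:R + Total k.+2 - Total k + zvar * (Total k + Total k.+1)).
  by ring.
have deltaE n : ((k == 0%N)%:R : fps rat) n = ((k == 0%N) && (n == 0%N))%:R.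
  by case: (k == 0%N); rewrite ?fps1E.
apply/fpsP => -[|[|n]]; rewrite !(fpsDE, fpsNE, fpsXM) !deltaE /= ?t0 ?t1S.
- by case: (k == 0%N) => /=; lra.
- case: k {deltaE} => [|k] /=; last by rewrite !t1S; lra.
  by rewrite t_axis_rec !t0 /=; lra.
- have := congr1 (fun i : int => i%:~R : rat) (t_height_rec n k).
  by rewrite !(rmorphD, rmorphN) /= -!pmulrn => ->; rewrite andbF; lra.
Qed.

(** The difference of two solutions satisfies the homogeneous recurrences,
    which express its coefficient of z^n at height k + 1 by the one at height k
    and by coefficients of lower degree.  So it vanishes, by induction on n and
    then on k. *)
Lemma kernel_recurrence_uniq (e : fps rat) (d U W : nat -> fps rat) :
  U 0%N = e + zvar * (U 0%N + U 1%N) ->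
  W 0%N = e + zvar * (W 0%N + W 1%N) ->
  (forall k, U k.+1 = U k + zvar * (U k.+1 + U k.+2)
     - (1 - zvar) * (d k + zvar * (U k + U k.+1))) ->
  (forall k, W k.+1 = W k + zvar * (W k.+1 + W k.+2)
     - (1 - zvar) * (d k + zvar * (W k + W k.+1))) ->
  U =1 W.
Proof.
move=> U0 W0 US WS k; apply/subr0_eq; set E := fun k => U k - W k.
rewrite -/(E k).
have E0 : E 0%N = zvar * (E 0%N + E 1%N) by rewrite /E {1}U0 {1}W0; ring.
have ES j : E j.+1 = E j + zvar * (zvar * (E j + E j.+1) + E j.+2 - E j).
  by rewrite /E {1}US {1}WS; ring.
clearbody E.
apply/fpsP => n; rewrite fps0E; elim/ltn_ind: n k => n IH.
have low (h : fps rat) : (forall m, (m < n)%N -> h m = 0) -> (zvar * h) n = 0.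
  by case: n {IH} => [|m] hm; rewrite fpsXM ?hm.
elim=> [|k IHk].
  by rewrite E0 low // => m ltm; rewrite fpsDE !IH // addr0.
rewrite ES fpsDE IHk low ?addr0 // => m ltm.
rewrite !(fpsDE, fpsNE, fpsXM) !IH // subr0 addr0.
by case: m ltm => // m ltm; rewrite fpsDE !IH ?addr0 // ltnW.
Qed.

(** * The quadratic relation behind r and s *)

Local Notation D := (zvar ^+ 2 - zvar + 1).

Lemma unit2 : (2 : fps rat) \is a GRing.unit.
Proof. by have := denom_unit; rewrite unitrM => /andP[]. Qed.

Lemma unitD : D \is a GRing.unit.
Proof. by have := denom_unit; rewrite unitrM => /andP[]. Qed.

(** This is s / z, and it turns out to be the generating function of the paths
    that end on the axis.  Defining it from r avoids dividing by z. *)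
Definition axis_ser : fps rat := (D * rser)^-1.

Lemma unitDr : D * rser \is a GRing.unit.
Proof. by rewrite unitrM unitD rser_unit. Qed.

Lemma rserE : 2 * D * rser = 1 - zvar ^+ 2 + fps_sqrt discr.
Proof. by rewrite mulrC divrK ?denom_unit. Qed.

Lemma sserE : 2 * D * sser = 1 - zvar ^+ 2 - fps_sqrt discr.
Proof. by rewrite mulrC divrK ?denom_unit. Qed.

Lemma rserV : rser^-1 = D * axis_ser.
Proof. by rewrite /axis_ser [in RHS]invrM ?unitD ?rser_unit // mulrC divrK ?unitD. Qed.

(** Equivalent to D r s = z, the product of the roots of
    D x^2 - (1 - z^2) x + z. *)
Lemma sserE_axis : sser = zvar * axis_ser.
Proof.
rewrite /axis_ser -[LHS](mulrK unitDr); congr (_ / _).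
apply: (mulrI denom_unit); apply: (mulrI unit2).
transitivity ((2 * D * sser) * (2 * D * rser)); first by ring.
rewrite rserE sserE -subr_sqr sqrt_discrK /discr; ring.
Qed.

(** The sum of the roots is D r + D s = 1 - z^2; multiply it by 1 / (D r). *)
Lemma axis_ser_eq : axis_ser = 1 + zvar ^+ 2 * axis_ser + zvar * D * axis_ser ^+ 2.
Proof.
have sum_rs : D * rser + D * sser = 1 - zvar ^+ 2.
  apply: (mulrI unit2); transitivity (2 * D * rser + 2 * D * sser); first by ring.
  by rewrite rserE sserE; ring.
have := congr1 ( *%R axis_ser) sum_rs.
rewrite mulrDr mulVr ?unitDr // sserE_axis => eq1.
apply/subr0_eq.
transitivity (axis_ser * (1 - zvar ^+ 2) - (1 + axis_ser * (D * (zvar * axis_ser)))).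
  by ring.
by rewrite eq1 subrr.
Qed.

(** * Closed forms *)

(** D A = 1/r, so beyond the axis this is a geometric sequence of ratio 1/r. *)
Definition height_ser k : fps rat :=
  if k is j.+1
  then (D * axis_ser) ^+ j * ((axis_ser - 1) * (D * axis_ser) + zvar ^+ 2 * axis_ser)
  else axis_ser.

(** The geometric sequence solves the recurrence because 1/r is a root of
    z q^2 - (1 - z^2) q + D. *)
Lemma Total_height_ser : Total =1 height_ser.
Proof.
(* The three recurrences to check, for the heights 0, 1 and at least 2, are
   multiples of the quadratic relation; the cofactors come from writing
   1 - z^2 - z D A as (1 - defect) / A. *)
set defect := 1 + zvar ^+ 2 * axis_ser + zvar * D * axis_ser ^+ 2 - axis_ser.
have defect0 : defect = 0 by rewrite /defect -axis_ser_eq subrr.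
apply: kernel_recurrence_uniq Total0 _ TotalS _ => [|[|k]] /=; apply/subr0_eq.
- by transitivity (- defect); [rewrite /defect; ring | rewrite defect0 oppr0].
- transitivity ((1 - zvar - D * axis_ser) * defect); last by rewrite defect0 mulr0.
  by rewrite /defect; ring.
- transitivity (- D * height_ser k.+1 * defect); last by rewrite defect0 mulr0.
  by rewrite /defect /height_ser !exprS; ring.
Qed.

Lemma Total_coef k :
  Total k = (k == 0%N)%:R + sser * (rser * zvar + 1) / rser ^+ k.+1 +
            (1 - (k == 0%N)%:R) * (sser * zvar / rser ^ (k%:Z - 1)).
Proof.
have rq : rser * (D * axis_ser) = 1 by rewrite -rserV divrr ?rser_unit.
have axis_serB1 : axis_ser - 1 = zvar ^+ 2 * axis_ser + zvar * D * axis_ser ^+ 2.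
  by rewrite {1}axis_ser_eq; ring.
have coefE j : sser * (rser * zvar + 1) / rser ^+ j.+1 =
               (D * axis_ser) ^+ j * (axis_ser - 1).
  rewrite -exprVn rserV sserE_axis axis_serB1 exprS.
  transitivity ((D * axis_ser) ^+ j * (zvar ^+ 2 * axis_ser * (rser * (D * axis_ser))
     + zvar * D * axis_ser ^+ 2)); first by ring.
  by rewrite rq mulr1.
rewrite coefE Total_height_ser; case: k => [|k] /=.
  by rewrite subrr mul0r addr0 expr0 mul1r addrC subrK.
have -> : k.+1%:Z - 1 = k by lia.
rewrite subr0 add0r mul1r -exprnP -exprVn rserV.
by rewrite sserE_axis (exprS (D * axis_ser)); ring.
Qed.

(** * The bivariate series *)

Lemma fpsCD (R : comNzRingType) (a b : R) : (a + b)%:S = a%:S + b%:S.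
Proof. by apply/fpsP => -[|n] //=; rewrite addr0. Qed.

Lemma fpsCM_morph (R : comNzRingType) (a b : R) : (a * b)%:S = a%:S * b%:S.
Proof. by apply/fpsP => -[|n]; rewrite fpsCM //= mulr0. Qed.

Lemma fpsC1 (R : comNzRingType) : (1 : R)%:S = 1.
Proof. by []. Qed.

Lemma Total_bivariate :
  Total = 1 + sser%:S *
              (1 + rser%:S * zvar%:S + rser%:S * uvar * zvar%:S) /
              (rser%:S - uvar).
Proof.
rewrite inv_r_sub_u; set Q := FPS _.
have -> : 1 + sser%:S * (1 + rser%:S * zvar%:S + rser%:S * uvar * zvar%:S) * Q
  = 1 + (sser * (rser * zvar + 1))%:S * Q
    + uvar * ((sser * (rser * zvar))%:S * Q).
  by rewrite !(fpsCM_morph, fpsCD) fpsC1; ring.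
apply/fpsP => k; rewrite Total_coef !fpsDE fpsXM fps1E.
case: k => [|k]; rewrite !fpsCM /=.
  by rewrite subrr mul0r.
have -> : k.+1%:Z - 1 = k by lia.
rewrite subr0 mul1r -exprnP; congr (_ + _).
rewrite exprS invrM ?unitrX ?rser_unit //.
transitivity (sser * zvar * rser ^- k * (rser * rser^-1)); last by ring.
by rewrite divrr ?rser_unit // mulr1.
Qed.

(** * The convolution formula on the axis *)

Lemma Total0_quadratic :
  Total 0 = 1 + zvar ^+ 2 * Total 0 + zvar * D * Total 0 ^+ 2.
Proof. by rewrite Total_height_ser /= -axis_ser_eq. Qed.

(** The coefficient of z^(n+2) in the quadratic relation, where
    z D A^2 = z A^2 - z^2 A^2 + z^3 A^2.  The predecessor in the last sum is
    harmless at [n = 0], where the sum is empty. *)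
Lemma t0_quadratic n :
  (t n.+2 0)%:Z = (t n 0)%:Z
    + \sum_(0 <= k < n.+2) (t k 0)%:Z * (t (n.+1 - k) 0)%:Z
    - \sum_(0 <= k < n.+1) (t k 0)%:Z * (t (n - k) 0)%:Z
    + \sum_(0 <= k < n) (t k 0)%:Z * (t (n.-1 - k) 0)%:Z.
Proof.
apply: (@intr_inj rat); rewrite !(rmorphD, rmorphN) /= !rmorph_sum /=.
have sqE m : \sum_(0 <= i < m.+1) ((t i 0)%:Z * (t (m - i) 0)%:Z)%:~R =
   (Total 0 ^+ 2) m.
  rewrite expr2 fpsME big_mkord; apply: eq_bigr => i _.
  by rewrite rmorphM.
transitivity (Total 0 n.+2) => //; rewrite {1}Total0_quadratic.
have -> : 1 + zvar ^+ 2 * Total 0 + zvar * D * Total 0 ^+ 2 =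
  1 + zvar * (zvar * Total 0 + Total 0 ^+ 2 - zvar * Total 0 ^+ 2
              + zvar * (zvar * Total 0 ^+ 2)) by ring.
rewrite !(fpsDE, fpsNE, fpsXM) fps1E add0r !sqE.
by case: n => [|n] /=; [rewrite big_geq | rewrite sqE].
Qed.

(** The summands k = 0 of the first convolution in [t0_quadratic] give
    t(n+1, 0); the others pair with the second convolution into differences
    of consecutive terms, and t(0, 0) = t(1, 0) removes the difference k = 1. *)
Lemma t0_convolution n :
  (t n.+2 0)%:Z = (t n.+1 0)%:Z + (t n 0)%:Z
    + \sum_(0 <= k < n) (t k 0)%:Z * (t (n.-1 - k) 0)%:Z
    + \sum_(2 <= k < n.+2)
        ((t k 0)%:Z - (t k.-1 0)%:Z) * (t (n.+1 - k) 0)%:Z.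
Proof.
rewrite t0_quadratic.
(* The difference at k = 1 can be added to the sum, since it is zero. *)
have t10 : t 1 0 = 1%N by rewrite t_axis_rec !t0.
rewrite big_ltn // t0 subn0 mul1r.
have -> : \sum_(2 <= k < n.+2) ((t k 0)%:Z - (t k.-1 0)%:Z) * (t (n.+1 - k) 0)%:Z
        = \sum_(1 <= k < n.+2) ((t k 0)%:Z - (t k.-1 0)%:Z) * (t (n.+1 - k) 0)%:Z.
  by rewrite [RHS]big_ltn //= t10 t0 subrr mul0r add0r.
under [X in _ = _ + X]eq_bigr do rewrite mulrBl.
rewrite sumrB [X in _ = _ + (_ - X)]big_add1 /=.
under [X in _ = _ + (_ - X)]eq_bigr do rewrite subSS.
ring.
Qed.

Theorem theorem2 :
  [/\ Total = 1 + sser%:S *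
                  (1 + rser%:S * zvar%:S + rser%:S * uvar * zvar%:S) /
                  (rser%:S - uvar),
      (forall k : nat,
         Total k = (k == 0%N)%:R + sser * (rser * zvar + 1) / rser ^+ k.+1 +
                   (1 - (k == 0%N)%:R) * (sser * zvar / rser ^ (k%:Z - 1))),
      (forall n k : nat, (2 <= n)%N -> (1 <= k)%N ->
         (t n k)%:Z = (t (n - 2) (k - 1))%:Z + (t (n - 2) k)%:Z
                      - (t (n - 1) (k - 1))%:Z + (t (n - 1) (k + 1))%:Z
                      + (t n (k - 1))%:Z) &
      (forall n : nat, (2 <= n)%N ->
         (t n 0)%:Z = (t (n - 1) 0)%:Z + (t (n - 2) 0)%:Z
           + \sum_(0 <= k < n - 2) (t k 0)%:Z * (t (n - k - 3) 0)%:Z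
           + \sum_(2 <= k < n)
               ((t k 0)%:Z - (t (k - 1) 0)%:Z) * (t (n - k - 1) 0)%:Z)].
Proof.
split.
- exact: Total_bivariate.
- exact: Total_coef.
- by move=> [|[|n]] // [|k] // _ _; rewrite !subSS !subn0 addn1 t_height_rec.
- move=> [|[|n]] // _; rewrite t0_convolution !subSS !subn0.
  congr (_ + _ + _); apply: eq_big_nat => k /andP[? ?].
    by congr (_ * (t _ 0)%:Z); lia.
  by rewrite subn1; congr (_ * (t _ 0)%:Z); lia.
Qed.
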